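(* Let $H$ be a real Hilbert space, $C \subset H$ a nonempty closed convex set, and $w_1,\dots,w_m>0$. Let $$\Delta = \{a=(a_1,\dots,a_m)\in H^m : a_1,\dots,a_m \text{ are not collinear}\}.$$ For $a \in \Delta$ let $$v(a) = \inf_{x\in C} \sum_{i=1}^m w_i\|x-a_i\|$$ be the optimal value, and let $M(a)\in C$ be the unique minimizer of $x\mapsto \sum_{i=1}^m w_i\|x-a_i\|$ over $C$. Then the solution mapping $M:\Delta\to H$ is continuous on $\Delta$, and the optimal value function $v:\Delta\to\mathbb{R}$ is convex and locally Lipschitz on $\Delta$.
   Context: Points $a_1,\dots,a_m$ are collinear if some straight line of $H$ contains all of them. For $a\in\Delta$ the minimizer over $C$ exists and is unique, so $M$ is well defined. $H^m$ carries the product (norm) topology and $H$ the norm topology. Since $\Delta$ need not be a convex set, convexity of $v$ on $\Delta$ means $v(\lambda a+(1-\lambda)b)\le \lambda v(a)+(1-\lambda)v(b)$ whenever $\lambda\in[0,1]$ and $a$, $b$, $\lambda a+(1-\lambda)b\in\Delta$. *)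

(* Defs.v *)
From HB Require Import structures.
From mathcomp Require Import all_boot all_order all_algebra.
From mathcomp Require Import all_classical all_reals all_analysis.

Set Implicit Arguments.
Unset Strict Implicit.
Unset Printing Implicit Defensive.

Import Order.TTheory GRing.Theory Num.Theory.
Import numFieldNormedType.Exports.

Local Open Scope classical_set_scope.
Local Open Scope ring_scope.

(* A real Hilbert space: a complete normed space over R whose norm is induced
   by an inner product (a symmetric positive definite bilinear form). *)
HB.mixin Record isHilbert (R : realType) H & CompleteNormedModule R H := {
  inner : {dot H for (@idfun R)};
  sqr_norm_inner : forall x : H, `|x| ^+ 2 = inner x x }.

#[short(type="hilbertType")]
HB.structure Definition Hilbert (R : realType) :=
  {H of CompleteNormedModule R H & isHilbert R H}.

(* The power V^I of a normed space carries the maximum norm (as the library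
   does for pairs and for matrices), hence the product topology; see
   [cvg_ffunP]. *)
Section FfunNorm.
Context (R : realType) (I : finType) (V : normedModType R).
Implicit Types f g : {ffun I -> V}.

Definition ffun_norm f : R := \big[Num.max/0]_(i : I) `|f i|.

Lemma ffun_norm_le f (c : R) :
  0 <= c -> ffun_norm f <= c <-> forall i, `|f i| <= c.
Proof.
move=> c0; split=> [+ i|fc]; last by apply/bigmax_leP; split.
by apply: le_trans; exact: le_bigmax.
Qed.

Lemma ffun_norm_ge0 f : 0 <= ffun_norm f.
Proof. exact: bigmax_ge_id. Qed.

Lemma ffun_norm_proj f i : `|f i| <= ffun_norm f.
Proof. exact: le_bigmax. Qed.

Lemma ffun_normD f g : ffun_norm (f + g) <= ffun_norm f + ffun_norm g.
Proof.
apply/ffun_norm_le => [|i]; first by rewrite addr_ge0 ?ffun_norm_ge0.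
by rewrite ffunE (le_trans (ler_normD _ _))// lerD ?ffun_norm_proj.
Qed.

Lemma ffun_normZ (l : R) f : ffun_norm (l *: f) = `|l| * ffun_norm f.
Proof.
rewrite /ffun_norm (eq_bigr (fun i => `|l| * `|f i|)); last first.
  by move=> i _; rewrite ffunE normrZ.
elim/big_rec2: _ => [|i x y _ ->]; first by rewrite mulr0.
by rewrite maxr_pMr.
Qed.

Lemma ffun_norm_eq0 f : ffun_norm f = 0 -> f = 0.
Proof.
move=> f0; apply/ffunP => i; rewrite ffunE; apply/eqP.
by rewrite -normr_le0 -f0 ffun_norm_proj.
Qed.

HB.instance Definition _ :=
  Lmodule_isNormed.Build R {ffun I -> V} ffun_normD ffun_normZ ffun_norm_eq0.

End FfunNorm.

Lemma cvg_ffunP (R : realType) (I : finType) (V : normedModType R)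
    (F : set_system {ffun I -> V}) (FF : Filter F) (f : {ffun I -> V}) :
  F --> f <-> forall i, (fun g : {ffun I -> V} => g i) @ F --> f i.
Proof.
split=> [Ff i|Ff].
  apply/cvgrPdist_le => e e0; move/cvgrPdist_le : Ff => /(_ e e0).
  apply: filterS => g; apply: le_trans.
  by rewrite (le_trans _ (ffun_norm_proj _ i))// !ffunE.
apply/cvgrPdist_le => e e0.
have : F [set g : {ffun I -> V} | forall i, `|f i - g i| <= e].
  by apply: filter_forall => i; move/cvgrPdist_le : (Ff i) => /(_ e e0).
apply: filterS => g fg.
by apply/(ffun_norm_le _ (ltW e0)) => i; rewrite !ffunE.
Qed.

Section Location.
Context (R : realType) (H : hilbertType R) (m : nat).
Implicit Types (a : {ffun 'I_m -> H}) (w : 'I_m -> R) (C : set H).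

Definition collinear a :=
  exists p d : H, d != 0 /\ forall i, exists t : R, a i = p + t *: d.

Definition noncollinear : set {ffun 'I_m -> H} := [set a | ~ collinear a].

Definition wdist w a (x : H) : R := \sum_(i < m) w i * `|x - a i|.

Definition optval C w a : R := inf [set wdist w a x | x in C].

Definition minimizers C w a : set H :=
  [set x | C x /\ forall y, C y -> wdist w a x <= wdist w a y].

(* [get] picks an element of the set of minimizers, i.e. the minimizer where it
   exists and is unique; elsewhere the value is irrelevant. *)
Definition solution C w a : H := get (minimizers C w a).

End Location.

Arguments noncollinear {R} H m.

(* Differs from [convex_function] in that D need not be convex: the inequality
   is only required when the convex combination lies in D. *)
Definition convex_on (R : realType) (V : lmodType R) (D : set V) (f : V -> R) :=
  forall (a b : V) (t : R), 0 <= t <= 1 -> D a -> D b ->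
    D (t *: a + (1 - t) *: b) ->
    f (t *: a + (1 - t) *: b) <= t * f a + (1 - t) * f b.

(* Unlike [locally [lipschitz f x | x in D]], which quantifies over pairs of
   points of D, this is literally the Lipschitz condition in the trace on D of a
   neighbourhood of each point. *)
Definition locally_lipschitz_on (R : realType) (V W : normedModType R)
    (D : set V) (f : V -> W) :=
  forall a, D a -> exists2 U : set V, nbhs a U & [lipschitz f x | x in D `&` U].

(* Main.v *)
(* For non-collinear a, the weighted distance sum has a midpoint gap
   f x + f y - 2 f ((x + y) / 2) >= c |x - y|^2 on each of its sublevel sets.
   Indeed |p| + |q| - |p + q| is bounded below by the Gram determinant of p and
   p - q up to a factor depending on a bound for |p| and |q|, and the sum over i
   of the Gram determinants of (x - a_i, d) can be small compared to |d|^2 only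
   if the a_i lie nearly on a line of direction d.
   So minimizing sequences in C are Cauchy (no weak compactness is needed), and
   approximate minimizers of f are near the minimizer. As f changes by at most
   (sum of w_i) |b - a| when a is replaced by b, this gives continuity of the
   solution and the Lipschitz bound for the optimal value. Convexity follows
   from joint convexity of the objective in (a, x). *)

Require Import Defs.
From mathcomp Require Import all_boot all_order all_algebra.
From mathcomp Require Import all_classical all_reals all_analysis.
From mathcomp Require Import ring lra.

Set Implicit Arguments.
Unset Strict Implicit.
Unset Printing Implicit Defensive.

Import Order.TTheory GRing.Theory Num.Theory.
Import numFieldNormedType.Exports.

Local Open Scope classical_set_scope.
Local Open Scope ring_scope.

(** * Gram determinants of pairs of vectors *)

Section Gram.
Context (R : realType) (H : hilbertType R).
Implicit Types (x y d p q u v : H) (k r : R).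

Lemma innerC x y : inner x y = inner y x.
Proof. by rewrite (hermC inner) expr0 mul1r. Qed.

Lemma innerDl x y d : inner (x + y) d = inner x d + inner y d.
Proof. exact: (linearDl inner). Qed.

Lemma innerNl x d : inner (- x) d = - inner x d.
Proof. exact: (linearNl inner). Qed.

Lemma innerZl k x d : inner (k *: x) d = k * inner x d.
Proof. exact: (linearZl_LR inner). Qed.

Lemma innerDr x y d : inner d (x + y) = inner d x + inner d y.
Proof. by rewrite innerC innerDl !(innerC d). Qed.

Lemma innerNr x d : inner d (- x) = - inner d x.
Proof. by rewrite innerC innerNl (innerC d). Qed.

Lemma innerZr k x d : inner d (k *: x) = k * inner d x.
Proof. by rewrite innerC innerZl (innerC d). Qed.

Definition innerE := (innerDl, innerNl, innerZl, innerDr, innerNr, innerZr).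

Definition gram x d : R := `|x| ^+ 2 * `|d| ^+ 2 - inner x d ^+ 2.

(** The vector on the left is [|d|^2] times the component of [x] orthogonal to [d]; hence
    Cauchy-Schwarz and its equality case. *)
Lemma sqr_norm_reject x d :
  `| `|d| ^+ 2 *: x - inner x d *: d| ^+ 2 = `|d| ^+ 2 * gram x d.
Proof. by rewrite /gram !sqr_norm_inner !innerE (innerC d x); ring. Qed.

Lemma gram_ge0 x d : 0 <= gram x d.
Proof.
have [->|d0] := eqVneq d 0.
  by rewrite /gram normr0 (linear0r inner) !expr0n mulr0 subr0.
have d2 : 0 < `|d| ^+ 2 by rewrite exprn_gt0// normr_gt0.
by rewrite -(pmulr_rge0 _ d2) -sqr_norm_reject sqr_ge0.
Qed.

Lemma gram_eq0_scale x d : d != 0 -> gram x d = 0 -> exists k, x = k *: d.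
Proof.
move=> d0 g0; exists (inner x d / `|d| ^+ 2).
have d2 : `|d| ^+ 2 != 0 by rewrite expf_neq0// normr_eq0.
have /eqP := sqr_norm_reject x d.
rewrite g0 mulr0 sqrf_eq0 normr_eq0 subr_eq0 => /eqP dx.
by rewrite mulrC -scalerA -dx scalerA mulVf// scale1r.
Qed.

(* [gram ^~ d] is a nonnegative quadratic form, so it satisfies the
   parallelogram identity. *)
Lemma gramB_le x y d : gram (x - y) d <= 2 * (gram x d + gram y d).
Proof.
have <- : gram (x - y) d + gram (x + y) d = 2 * (gram x d + gram y d).
  by rewrite /gram !sqr_norm_inner !innerE; ring.
by rewrite lerDl gram_ge0.
Qed.

(** With [t = inner p q], the Gram determinant factors as [(|p| |q| - t) (|p| |q| + t)]. The first
    factor is half of [(|p| + |q| - |p + q|) (|p| + |q| + |p + q|)], so at most [2 r] times the gap;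
    the second is at most [2 r^2]. *)
Lemma normD_gap p q r : `|p| <= r -> `|q| <= r ->
  gram p (p - q) <= 4 * r ^+ 3 * (`|p| + `|q| - `|p + q|).
Proof.
move=> pr qr.
have p0 := normr_ge0 p; have q0 := normr_ge0 q; have s0 := normr_ge0 (p + q).
have tri := ler_normD p q.
have sE : `|p + q| ^+ 2 = `|p| ^+ 2 + `|q| ^+ 2 + 2 * inner p q.
  by rewrite !sqr_norm_inner !innerE (innerC q p); ring.
have gE : gram p (p - q) = (`|p| * `|q|) ^+ 2 - inner p q ^+ 2.
  by rewrite exprMn /gram !sqr_norm_inner !innerE (innerC q p); ring.
rewrite gE.
move: `|p| `|q| `|p + q| (inner p q) p0 q0 s0 tri sE pr qr {gE} => a b s t.
move=> a0 b0 s0 tri sE ar br.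
have r0 : 0 <= r by exact: le_trans ar.
have eE : 2 * (a * b - t) = (a + b - s) * (a + b + s) by lra.
have e0 : 0 <= a * b - t by nra.
have e1 : a * b - t <= 2 * r * (a + b - s) by nra.
have ab : a * b <= r ^+ 2 by rewrite expr2 ler_pM.
have f1 : a * b + t <= 2 * r ^+ 2 by lra.
have r2 : 0 <= 2 * r ^+ 2 by rewrite mulr_ge0// sqr_ge0.
rewrite subr_sqr (le_trans (ler_wpM2l e0 f1))//.
by apply: le_trans (ler_wpM2r r2 e1) _; lra.
Qed.

(** Quantifies that two vectors nearly parallel to [d] are nearly parallel to each other. *)
Lemma gram_le u v d :
  gram u v * `|d| ^+ 2 <=
  3 * (`|v| ^+ 2 * gram u d + `|u| ^+ 2 * gram v d).
Proof.
have [->|d0] := eqVneq d 0.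
  rewrite normr0 expr0n mulr0 mulr_ge0// addr_ge0//.
    by rewrite mulr_ge0 ?sqr_ge0 ?gram_ge0.
  by rewrite mulr_ge0 ?sqr_ge0 ?gram_ge0.
have d2 : 0 < `|d| ^+ 2 by rewrite exprn_gt0// normr_gt0.
set s := inner u d; set t := inner v d.
have := gramB_le (t *: u) (s *: v) d.
have -> : gram (t *: u) d = t ^+ 2 * gram u d.
  by rewrite /gram !sqr_norm_inner !innerE; ring.
have -> : gram (s *: v) d = s ^+ 2 * gram v d.
  by rewrite /gram !sqr_norm_inner !innerE; ring.
(* Split [u] and [v] along [d]: the first two terms are [|d|^4] times the Gram determinant of the
   orthogonal components, the last one collects the mixed terms. *)
have gE : gram u v * `|d| ^+ 2 * `|d| ^+ 2 = gram u d * gram v d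
    - (`|d| ^+ 2 * inner u v - s * t) ^+ 2 + gram (t *: u - s *: v) d.
  by rewrite /gram !sqr_norm_inner !innerE (innerC v u) -/s -/t; ring.
move=> P; rewrite -(ler_pM2r d2) gE.
have A0 := gram_ge0 u d; have B0 := gram_ge0 v d.
have E0 := sqr_ge0 (`|d| ^+ 2 * inner u v - s * t).
have D0 := ltW d2; have U0 := sqr_ge0 `|u|; have V0 := sqr_ge0 `|v|.
have AE : gram u d = `|u| ^+ 2 * `|d| ^+ 2 - s ^+ 2 by [].
have BE : gram v d = `|v| ^+ 2 * `|d| ^+ 2 - t ^+ 2 by [].
have AV : 0 <= gram u d * (`|v| ^+ 2 * `|d| ^+ 2 - gram v d).
  by rewrite mulr_ge0// BE opprB addrC subrK sqr_ge0.
have BU : 0 <= gram v d * (`|u| ^+ 2 * `|d| ^+ 2 - gram u d).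
  by rewrite mulr_ge0// AE opprB addrC subrK sqr_ge0.
have BU0 : 0 <= gram v d * (`|u| ^+ 2 * `|d| ^+ 2) by rewrite !mulr_ge0.
have tE : t ^+ 2 = `|v| ^+ 2 * `|d| ^+ 2 - gram v d by rewrite BE; ring.
have sE : s ^+ 2 = `|u| ^+ 2 * `|d| ^+ 2 - gram u d by rewrite AE; ring.
rewrite tE sE in P.
have AB0 : 0 <= gram u d * gram v d by rewrite mulr_ge0.
lra.
Qed.

End Gram.

(** * The weighted distance sum *)

Section Weber.
Context (R : realType) (H : hilbertType R) (m : nat) (w : 'I_m -> R).
Hypothesis w_gt0 : forall i, 0 < w i.
Implicit Types (a b : {ffun 'I_m -> H}) (C : set H) (x y d : H) (L r : R).

(** If all these determinants vanish, the points lie on the line through [a i] and some other [a j].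
    The vector [d] supplies a direction when there are no points or all coincide. *)
Lemma noncollinear_gram_neq0 a d : d != 0 -> ~ collinear a ->
  exists i j k, gram (a j - a i) (a k - a i) != 0.
Proof.
move=> d0 na; apply: contrapT => ng; apply: na.
have g0 i j k : gram (a j - a i) (a k - a i) = 0.
  by apply/eqP; apply: contra_notT ng => gijk; exists i, j, k.
have [[i]|noi] := pselect (exists i : 'I_m, True); last first.
  by exists 0, d; split => // i; case: noi; exists i.
move=> _; have [[j aj]|eqa] := pselect (exists j, a j - a i != 0).
  exists (a i), (a j - a i); split => // k.
  have [t kt] := gram_eq0_scale aj (g0 i k j).
  by exists t; rewrite -kt addrC subrK.
exists (a i), d; split => // j; exists 0; rewrite scale0r addr0.
apply/eqP; rewrite -subr_eq0; apply: contra_notT eqa => aj.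
by exists j.
Qed.

(** The sum controls [gram (x - a l) d] for every [l], hence by differences [gram (a l - a i) d],
    which no longer involves [x]. Then [gram_le] applies to a triple of points with nonzero Gram
    determinant. *)
Lemma sum_gram_ge a : ~ collinear a -> exists2 c, 0 < c &
  forall x d, c * `|d| ^+ 2 <= \sum_(i < m) w i * gram (x - a i) d.
Proof.
move=> na; have [[d0 d0N0]|dall] := pselect (exists d : H, d != 0); last first.
  (* In the zero space both sides vanish, so any constant will do. *)
  exists 1 => // x d; have -> : d = 0.
    by apply/eqP; apply: contra_notT dall => dN0; exists d.
  rewrite normr0 expr0n mulr0 sumr_ge0// => i _.
  by rewrite mulr_ge0 ?gram_ge0// ltW.
have [i [j [k g0]]] := noncollinear_gram_neq0 d0N0 na.
set u := a j - a i in g0; set v := a k - a i in g0.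
have {}g0 : 0 < gram u v by rewrite lt_def g0 gram_ge0.
pose K l := 2 * ((w l)^-1 + (w i)^-1).
have K0 l : 0 < K l by rewrite mulr_gt0// addr_gt0// invr_gt0.
have Kle x d l :
    gram (a l - a i) d <= K l * \sum_(n < m) w n * gram (x - a n) d.
  set S := \sum_(n < m) _.
  have leS n : gram (x - a n) d <= (w n)^-1 * S.
    rewrite mulrC ler_pdivlMr// mulrC /S (bigD1 n)//= lerDl sumr_ge0// => h _.
    by rewrite mulr_ge0 ?gram_ge0// ltW.
  have -> : a l - a i = (x - a i) - (x - a l).
    by rewrite opprB [RHS]addrC addrA subrK.
  rewrite (le_trans (gramB_le _ _ _))// /K -mulrA ler_pM2l// addrC mulrDl.
  by rewrite lerD.
pose q := 3 * (`|v| ^+ 2 * K j + `|u| ^+ 2 * K k) + 1.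
have q0 : 0 < q.
  by rewrite ltr_wpDl// mulr_ge0// addr_ge0// mulr_ge0 ?sqr_ge0// ltW.
exists (gram u v / q); first by rewrite divr_gt0.
move=> x d; rewrite mulrAC ler_pdivrMr//.
set S := \sum_(n < m) _.
have S0 : 0 <= S.
  by apply: sumr_ge0 => n _; rewrite mulr_ge0 ?gram_ge0// ltW.
apply: (le_trans (gram_le _ _ _)).
rewrite [leRHS]mulrDr mulr1 ler_wpDr//.
rewrite [leRHS]mulrCA ler_pM2l// [leRHS]mulrC mulrDl.
by apply: lerD; rewrite -[leRHS]mulrA ler_wpM2l ?sqr_ge0//; exact: Kle.
Qed.

Lemma wdist_ge0 a x : 0 <= wdist w a x.
Proof. by apply: sumr_ge0 => i _; rewrite mulr_ge0// ltW. Qed.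

Lemma wdist_dist_le a x L : wdist w a x <= L ->
  forall i, `|x - a i| <= L / w i.
Proof.
move=> xL i; rewrite ler_pdivlMr// mulrC (le_trans _ xL)//.
rewrite /wdist (bigD1 i)//= lerDl sumr_ge0// => j _.
by rewrite mulr_ge0// ltW.
Qed.

(** Apply [normD_gap] to [x - a i] and [y - a i], whose sum is twice the midpoint minus [a i] and
    whose difference is [x - y]. *)
Lemma wdist_midpoint_gap a x y r :
  (forall i, `|x - a i| <= r) -> (forall i, `|y - a i| <= r) ->
  \sum_(i < m) w i * gram (x - a i) (x - y) <=
  4 * r ^+ 3 * (wdist w a x + wdist w a y - 2 * wdist w a (2^-1 *: (x + y))).
Proof.
move=> xr yr; rewrite /wdist -big_split/= mulr_sumr -sumrB mulr_sumr.
apply: ler_sum => i _.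
have -> : 2 * (w i * `|2^-1 *: (x + y) - a i|) =
          w i * `|(x - a i) + (y - a i)|.
  have -> : (x - a i) + (y - a i) = 2 *: (2^-1 *: (x + y) - a i).
    rewrite scalerBr scalerA mulfV ?pnatr_eq0// scale1r scaler_nat mulr2n.
    by rewrite opprD addrACA.
  by rewrite normrZ ger0_norm// mulrCA.
rewrite -mulrDr -mulrBr mulrCA ler_pM2l//.
have -> : x - y = (x - a i) - (y - a i) by rewrite opprB addrA subrK.
exact: normD_gap.
Qed.

(* On a sublevel set the distances [|x - a i|] are bounded, so there the
   midpoint gap is at least quadratic. *)
Lemma wdist_strongly_convex a L : ~ collinear a -> exists2 c, 0 < c &
  forall x y, wdist w a x <= L -> wdist w a y <= L ->
    c * `|x - y| ^+ 2 <=
    wdist w a x + wdist w a y - 2 * wdist w a (2^-1 *: (x + y)).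
Proof.
move=> /sum_gram_ge[c c0 cle].
(* A common bound for all [L / w i]; the absolute values allow negative [L], and the added 1 makes
   [r] positive. *)
pose r := \sum_(i < m) `|L / w i| + 1.
have r0 : 0 < r by rewrite ltr_wpDl// sumr_ge0.
have rle i : L / w i <= r.
  rewrite (le_trans (ler_norm _))// /r (bigD1 i)//= -addrA lerDl.
  by rewrite addr_ge0// sumr_ge0.
have r3 : 0 < 4 * r ^+ 3 by rewrite mulr_gt0// exprn_gt0.
exists (c / (4 * r ^+ 3)); first by rewrite divr_gt0.
move=> x y xL yL; rewrite mulrAC ler_pdivrMr// [leRHS]mulrC.
rewrite (le_trans (cle x (x - y)))//.
by apply: wdist_midpoint_gap => i; exact: le_trans (wdist_dist_le _ i) (rle i).
Qed.

Lemma wdist_lipschitz a b x y :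
  `|wdist w b y - wdist w a x| <= (\sum_(i < m) w i) * (`|y - x| + `|b - a|).
Proof.
rewrite /wdist -sumrB (le_trans (ler_norm_sum _ _ _))// mulr_suml.
apply: ler_sum => i _; rewrite -mulrBr normrM (gtr0_norm (w_gt0 i)) ler_pM2l//.
rewrite (le_trans (ler_dist_dist _ _))//.
have -> : y - b i - (x - a i) = (y - x) - (b i - a i).
  by rewrite !opprD !opprK addrACA.
rewrite (le_trans (ler_normB _ _))// lerD2l.
by have := ffun_norm_proj (b - a) i; rewrite !ffunE.
Qed.

Lemma wdist_le_perturb a b x :
  wdist w b x <= wdist w a x + (\sum_(i < m) w i) * `|b - a|.
Proof.
have := wdist_lipschitz a b x x; rewrite subrr normr0 add0r.
by have := ler_norm (wdist w b x - wdist w a x); lra.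
Qed.

(** Each [x - a i] is linear in the pair [(a, x)]. *)
Lemma wdist_convex a b x y (t : R) : 0 <= t <= 1 ->
  wdist w (t *: a + (1 - t) *: b) (t *: x + (1 - t) *: y) <=
  t * wdist w a x + (1 - t) * wdist w b y.
Proof.
move=> /andP[t0 t1]; rewrite /wdist !mulr_sumr -big_split/=.
apply: ler_sum => i _; rewrite !ffunE (mulrCA t) (mulrCA (1 - t)) -mulrDr.
rewrite ler_pM2l// opprD addrACA -!scalerBr.
by rewrite (le_trans (ler_normD _ _))// !normrZ !ger0_norm ?subr_ge0.
Qed.

(** * The optimal value and existence of a minimizer *)

Lemma optval_le C a x : C x -> optval C w a <= wdist w a x.
Proof.
move=> Cx; apply: ge_inf; last by exists x.
by exists 0 => _ [y _ <-]; exact: wdist_ge0.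
Qed.

Lemma optval_adherent C a e : C !=set0 -> 0 < e ->
  exists x, C x /\ wdist w a x < optval C w a + e.
Proof.
move=> [x0 Cx0] e0.
have [|_ [x Cx <-] xlt] := @inf_adherent R [set wdist w a x | x in C] e e0.
  split; first by exists (wdist w a x0), x0.
  by exists 0 => _ [y _ <-]; exact: wdist_ge0.
by exists x.
Qed.

Lemma convex_set_conv C x y (t : R) :
  convex_set C -> 0 <= t <= 1 -> C x -> C y ->
  C (t *: x + (1 - t) *: y).
Proof.
move=> Ccv /andP[t0 t1] /mem_set Cx /mem_set Cy.
exact: set_mem (Ccv x y (Itv01 t0 t1) Cx Cy).
Qed.

Lemma convex_set_midpoint C x y : convex_set C -> C x -> C y ->
  C (2^-1 *: (x + y)).
Proof.
move=> Ccv Cx Cy; rewrite scalerDr.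
have -> : 2^-1 *: y = (1 - 2^-1) *: y by congr (_ *: _); lra.
by apply: convex_set_conv => //; apply/andP; split; lra.
Qed.

Lemma minimizers_nonempty C a : C !=set0 -> closed C -> convex_set C ->
  ~ collinear a -> minimizers C w a !=set0.
Proof.
move=> C0 Ccl Ccv na; set v := optval C w a.
have inv0 (n : nat) : 0 < n.+1%:R^-1 :> R by rewrite invr_gt0.
have /choice[u uP] : forall n : nat,
    exists x, C x /\ wdist w a x < v + n.+1%:R^-1.
  by move=> n; exact: optval_adherent.
have [c c0 cle] := wdist_strongly_convex (v + 1) na.
have uL n : wdist w a (u n) <= v + 1.
  by rewrite (le_trans (ltW (uP n).2))// lerD2l invf_le1 ?ler1n.
(* The midpoint lies in [C], so its value is at least [v], while the values at [u n] and [u k]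
   exceed [v] by less than the two slacks. *)
have udist n k : c * `|u n - u k| ^+ 2 <= n.+1%:R^-1 + k.+1%:R^-1.
  have := cle _ _ (uL n) (uL k).
  have := optval_le a (convex_set_midpoint Ccv (uP n).1 (uP k).1).
  have := (uP n).2; have := (uP k).2; rewrite -/v.
  move: n.+1%:R^-1 k.+1%:R^-1 => p q; lra.
have : cauchy (u @ \oo).
  apply: cauchy_exP => e e0.
  have e1 : 0 < c * e ^+ 2 / 2 by rewrite divr_gt0// mulr_gt0// exprn_gt0.
  have [N _ NP] := near_infty_natSinv_lt (PosNum e1).
  exists (u N); exists N => // n /= Nn; rewrite -ball_normE/=.
  rewrite -(ltr_pXn2r (_ : 0 < 2)%N) ?nnegrE ?(ltW e0)// -(ltr_pM2l c0).
  rewrite (le_lt_trans (udist N n))//.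
  have := NP _ (leqnn N); have := NP _ Nn => /=.
  by move: n.+1%:R^-1 N.+1%:R^-1 => p q; lra.
move=> /cauchy_cvgP; set l := lim (u @ \oo) => ul.
exists l; split.
  by apply: (closed_cvg C Ccl _ l ul); apply: nearW => n; exact: (uP n).1.
move=> y Cy; apply: le_trans (optval_le a Cy); rewrite -/v.
pose W := \sum_(i < m) w i.
have W0 : 0 <= W by apply: sumr_ge0 => i _; exact: ltW.
(* The Lipschitz bound in [x] passes the estimate to the limit point. *)
have lle n : wdist w a l <= v + n.+1%:R^-1 + W * `|l - u n|.
  have := wdist_lipschitz a a (u n) l; rewrite subrr normr0 addr0 -/W.
  have := (uP n).2; have := ler_norm (wdist w a l - wdist w a (u n)).
  by move: n.+1%:R^-1 => p; lra.
have : (fun n => v + n.+1%:R^-1 + W * `|l - u n|) @ \oo --> v + 0 + W * 0.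
  apply: cvgD; first by apply: cvgD; [exact: cvg_cst|exact: cvg_harmonic].
  apply: cvgMr; rewrite -(normr0 H) -(subrr l).
  by apply: cvg_norm; apply: cvgB => //; exact: cvg_cst.
rewrite addr0 mulr0 addr0 => h.
by apply: (ler_cvg_to _ h); [exact: cvg_cst|apply: nearW].
Qed.

(** * Dependence of the minimizer and the optimal value on the points *)

Section Solution.
Variable C : set H.
Hypotheses (C0 : C !=set0) (Ccl : closed C) (Ccv : convex_set C).

Lemma solutionP a : ~ collinear a -> minimizers C w a (solution C w a).
Proof. by move=> na; apply: getPex; exact: minimizers_nonempty. Qed.

Lemma optvalE a : ~ collinear a -> optval C w a = wdist w a (solution C w a).
Proof.
move=> /solutionP[Cs sle]; apply/eqP; rewrite eq_le optval_le//=.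
apply: lb_le_inf.
  by exists (wdist w a (solution C w a)), (solution C w a).
by move=> _ [y Cy <-]; exact: sle.
Qed.

(** The minimizer for [a] is a feasible test point for [b]. *)
Lemma optval_le_perturb a b : ~ collinear a -> ~ collinear b ->
  optval C w b <= optval C w a + (\sum_(i < m) w i) * `|b - a|.
Proof.
move=> na nb; rewrite (optvalE na).
by rewrite (le_trans (optval_le b (solutionP na).1))// wdist_le_perturb.
Qed.

Lemma optval_locally_lipschitz :
  locally_lipschitz_on (noncollinear H m) (optval C w).
Proof.
(* The Lipschitz constant is global, so the whole space serves as the neighbourhood. *)
move=> a na; exists setT; first exact: filterT.
rewrite setIT; apply: (@klipschitzW _ _ _ (\sum_(i < m) w i)).
  exact: (@globally_properfilter _ _ (a, a)).
move=> [b b'] [nb nb'] /=; rewrite ler_norml; apply/andP; split.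
  by have := optval_le_perturb nb nb'; rewrite distrC; lra.
by have := optval_le_perturb nb' nb; lra.
Qed.

Lemma optval_convex : convex_on (noncollinear H m) (optval C w).
Proof.
move=> a b t t01 na nb _; rewrite (optvalE na) (optvalE nb).
apply: le_trans (wdist_convex a b _ _ t01); apply: optval_le.
by apply: convex_set_conv => //; apply: (solutionP _).1.
Qed.

Lemma solution_continuous :
  {within noncollinear H m, continuous (solution C w)}.
Proof.
apply/subspace_continuousP => a na; apply/cvgrPdist_lt => e e0.
pose W := \sum_(i < m) w i.
have W0 : 0 <= W by apply: sumr_ge0 => i _; exact: ltW.
(* For [|a - b| <= 1] this sublevel set of the objective at [a] contains the minimizer for [b]:
   exchanging [a] and [b] costs [W |a - b|] in the objective and again in the optimal value. *)
have [c c0 cle] := wdist_strongly_convex (optval C w a + 2 * W) na.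
(* The midpoint gap is at most [2 W |a - b|], which must stay below [c e^2]; the added 1 keeps the
   divisor positive if [W = 0]. *)
pose d := Num.min 1 (c * e ^+ 2 / (2 * W + 1)).
have q0 : 0 < 2 * W + 1 by lra.
have d0 : 0 < d by rewrite lt_min ltr01 divr_gt0// mulr_gt0// exprn_gt0.
have : \forall b \near a, `|a - b| < d by apply/nbhs_normP; exists d.
rewrite /within /=; apply: filterS => b + nb.
rewrite lt_min => /andP[ab1]; rewrite ltr_pdivlMr// => abe.
have [Ca _] := solutionP na; have [Cb _] := solutionP nb.
have mid := optval_le a (convex_set_midpoint Ccv Ca Cb).
have ba := wdist_le_perturb b a (solution C w b).
have vba := optval_le_perturb na nb.
rewrite -/W (distrC b) -(optvalE nb) in ba vba.
have WN : W * `|a - b| <= W by rewrite ler_piMr// ltW.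
have := cle (solution C w a) (solution C w b).
rewrite -(optvalE na) => /(_ ltac:(lra) ltac:(lra)) h.
rewrite -(ltr_pXn2r (_ : 0 < 2)%N) ?nnegrE ?(ltW e0)// -(ltr_pM2l c0).
have := normr_ge0 (a - b); lra.
Qed.

End Solution.
End Weber.

Theorem theorem2p6 (R : realType) (H : hilbertType R) (C : set H) (m : nat)
    (w : 'I_m -> R) (C0 : C !=set0) (Ccl : closed C) (Ccv : convex_set C)
    (w_gt0 : forall i, 0 < w i) :
  [/\ {within noncollinear H m, continuous (solution C w)},
      convex_on (noncollinear H m) (optval C w) &
      locally_lipschitz_on (noncollinear H m) (optval C w)].
Proof.
split; first exact: solution_continuous.
- exact: optval_convex.
- exact: optval_locally_lipschitz.
Qed.
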